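(* Let $\mathcal T=\{(\pi_i,c_i)\}_{i=1}^n$ be the menu of available information acquisition technologies. Then $$\Sigma^{\mathrm{ICPS,Endog}}\subseteq\Sigma^{\mathrm{ICPS}}\subseteq\Sigma^{\mathrm{Bayes}}.$$ If at least one technology $i$ satisfies $\pi_i>0$ and $c_i$ sufficiently small, then the inclusion $\Sigma^{\mathrm{ICPS,Endog}}\subseteq\Sigma^{\mathrm{ICPS}}$ is strict.
   Context: Environment. $F$ is a finite set of firms and $L$ a finite set of workers. Each agent $i\in F\cup L$ has a private type $\theta_i\in\{H,L\}$ (high/low); types are independent with $\Pr(\theta_i=H)=q\in(0,1)$. The match surplus is $S(H,H)=\alpha$, $S(H,L)=S(L,H)=\beta$, $S(L,L)=\gamma$ with $\alpha>\beta>\gamma\ge 0$. Unmatched agents get payoff $0$. A matching is $\mu:F\to L\cup\{\emptyset\}$ assigning each firm to at most one worker and vice versa. An allocation $(\mu,p)$ is a matching together with a vector of transfers $p=(p_{f,\ell})$ between matched partners. $\pi_f$ and $\pi_\ell$ denote the (ex ante) expected payoffs under $(\mu,p)$; for a matched pair they sum to the expected surplus $\mathbb E[S(\theta_f,\theta_\ell)]$, split by the transfer (transferable utility). For a firm–worker pair write $\Pi_{f\ell}=\pi_f+\pi_\ell$. $(\mu,p)$ is individually rational if all expected payoffs are $\ge0$. $\Sigma^{\mathrm{Bayes}}$: individually rational allocations for which there is no pair $(f,\ell)$ with $\mathbb E[S(\theta_f,\theta_\ell)]>\Pi_{f\ell}$ (prior expectation). Tests. A test $(\pi,c)$ has accuracy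 $\pi\in[0,1]$ and cost $c\ge0$: with probability $\pi$ it reveals the true types $(\theta_f,\theta_\ell)$ of the testing pair, and with probability $1-\pi$ it reveals nothing (whether it reveals being independent of types). After observing the outcome the pair accepts the deviation on an event $A$ measurable with respect to the test outcome, and otherwise keeps its status quo payoffs. $\mathbb E[S(\theta_f,\theta_\ell)\mid\text{test}]$ is the resulting expected joint payoff $\mathbb E[S(\theta_f,\theta_\ell)\mathbf 1_A+\Pi_{f\ell}\mathbf 1_{A^c}]$, with $A$ chosen by the pair. The null test $(0,0)$ can always be chosen. $\Sigma^{\mathrm{ICPS}}$ (baseline): individually rational allocations for which no pair $(f,\ell)$ can obtain $\mathbb E[S(\theta_f,\theta_\ell)\mid\text{test}]-c>\Pi_{f\ell}$, where deviating pairs have access to a single exogenously given test $(\bar\pi,\bar c)$ (besides the null test). $\Sigma^{\mathrm{ICPS,Endog}}$: the menu $\mathcal T$ is a finite set of tests with $\pi_i\in[0,1]$, $c_i\ge0$, containing the null test $(0,0)$. With $V_{f\ell}(i)=\mathbb E[S(\theta_f,\theta_\ell)\mid\text{test }i]-c_i$, these are the individually rational allocations for which no pair $(f,\ell)$ satisfies $\max_{i\in\mathcal T}V_{f\ell}(i)>\Pi_{f\ell}$.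
   Formalization: The baseline test is assumed to belong to the menu; strictness is claimed only when there is at least one firm and one worker and the baseline set Σ^ICPS is nonempty, since otherwise the claims fail (e.g. menu {null,(1,0)} with baseline (1,0) makes both sets empty). *)

(* Defs.v *)
From mathcomp Require Import all_boot all_order all_algebra.
From mathcomp Require Import classical_sets reals.

Set Implicit Arguments.
Unset Strict Implicit.
Unset Printing Implicit Defensive.

Import Order.TTheory GRing.Theory Num.Theory.
Local Open Scope ring_scope.
Local Open Scope classical_set_scope.

(* A type is a boolean, [true] being the high type H and [false] the low
   type L. *)
Record primitives (R : realType) := Primitives {
  high_prob : R;   (* q *)
  surplusHH : R;   (* alpha *)
  surplusHL : R;   (* beta *)
  surplusLL : R;   (* gamma *)
  high_probP : 0 < high_prob < 1;
  surplusHH_gt : surplusHL < surplusHH;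
  surplusHL_gt : surplusLL < surplusHL;
  surplusLL_ge0 : 0 <= surplusLL
}.

Definition surplus (R : realType) (E : primitives R) (s t : bool) : R :=
  match s, t with
  | true, true => surplusHH E
  | true, false | false, true => surplusHL E
  | false, false => surplusLL E
  end.

Record test (R : realType) := Test { accuracy : R; cost : R }.

Definition null_test {R : realType} : test R := Test 0 0.

Definition valid_test (R : realType) (tau : test R) : Prop :=
  0 <= accuracy tau <= 1 /\ 0 <= cost tau.

Definition is_menu (R : realType) (n : nat) (T : 'I_n -> test R) : Prop :=
  (forall i, valid_test (T i)) /\ (exists i, T i = null_test).

(* Transfers between agents who are not matched together are set to 0, so
   that [transfer] carries exactly the data of a vector indexed by the matched
   pairs. *)
Record allocation (R : realType) (F W : finType) := Allocation {
  matching : F -> option W;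
  transfer : F -> W -> R;
  matching_inj : forall f f' w,
    matching f = Some w -> matching f' = Some w -> f = f';
  transfer_unmatched : forall f w, matching f <> Some w -> transfer f w = 0
}.

Section Stability.
Context {R : realType} (E : primitives R) {F W : finType}.

(* The type profiles of all agents, with the product law: this is the
   canonical space carrying independent types with Pr(H) = q. *)
Definition profile := {ffun (F + W)%type -> bool}.

Definition bernoulli_mass (p : R) (b : bool) : R := if b then p else 1 - p.

Definition profile_prob (theta : profile) : R :=
  \prod_a bernoulli_mass (high_prob E) (theta a).

Definition pair_surplus (f : F) (w : W) (theta : profile) : R :=
  surplus E (theta (inl f)) (theta (inr w)).

Definition prior_surplus (f : F) (w : W) : R :=
  \sum_(theta : profile) profile_prob theta * pair_surplus f w theta.

(* The firm collects the surplus of the match and pays the transfer to the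
   worker. *)
Definition firm_payoff (a : allocation R F W) (f : F) : R :=
  if matching a f is Some w then prior_surplus f w - transfer a f w else 0.

Definition worker_payoff (a : allocation R F W) (w : W) : R :=
  if [pick f | matching a f == Some w] is Some f then transfer a f w else 0.

Definition joint_payoff (a : allocation R F W) (f : F) (w : W) : R :=
  firm_payoff a f + worker_payoff a w.

Definition individually_rational (a : allocation R F W) : Prop :=
  (forall f, 0 <= firm_payoff a f) /\ (forall w, 0 <= worker_payoff a w).

(* [revealed] tells whether the test is informative; [None] is the
   uninformative outcome. *)
Definition test_outcome (f : F) (w : W) (theta : profile) (revealed : bool) :
    option (bool * bool) :=
  if revealed then Some (theta (inl f), theta (inr w)) else None.

(* E[S 1_A + Pi 1_(A^c)] where A is the event that the outcome of the test
   lies in B; the events of this form are exactly those measurable with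
   respect to the outcome. *)
Definition acceptance_value (tau : test R) (f : F) (w : W) (Pi : R)
    (B : {set option (bool * bool)}) : R :=
  \sum_(theta : profile) \sum_(revealed : bool)
    profile_prob theta * bernoulli_mass (accuracy tau) revealed *
    (if test_outcome f w theta revealed \in B
     then pair_surplus f w theta else Pi).

(* E[S | test], the event A being chosen optimally. The default value of the
   maximum is itself one of the values over which it ranges. *)
Definition tested_surplus (tau : test R) (f : F) (w : W) (Pi : R) : R :=
  \big[Num.max/acceptance_value tau f w Pi finset.set0]_
      (B : {set option (bool * bool)})
    acceptance_value tau f w Pi B.

Definition test_value (a : allocation R F W) (f : F) (w : W) (tau : test R) : R :=
  tested_surplus tau f w (joint_payoff a f w) - cost tau.

(* For a menu, which contains the null test, the default value is again one of
   the values over which the maximum ranges. *)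
Definition menu_value (n : nat) (T : 'I_n -> test R)
    (a : allocation R F W) (f : F) (w : W) : R :=
  \big[Num.max/test_value a f w null_test]_(i < n) test_value a f w (T i).

Definition Sigma_Bayes : set (allocation R F W) :=
  [set a | individually_rational a /\
     ~ exists f w, joint_payoff a f w < prior_surplus f w].

Definition Sigma_ICPS (base : test R) : set (allocation R F W) :=
  [set a | individually_rational a /\
     ~ exists f w, joint_payoff a f w < test_value a f w null_test \/
                   joint_payoff a f w < test_value a f w base].

Definition Sigma_ICPS_Endog (n : nat) (T : 'I_n -> test R) :
    set (allocation R F W) :=
  [set a | individually_rational a /\
     ~ exists f w, joint_payoff a f w < menu_value T a f w].

End Stability.

Arguments Sigma_Bayes {R} E F W.
Arguments Sigma_ICPS {R} E F W base.
Arguments Sigma_ICPS_Endog {R} E F W {n} T.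

(* Main.v *)
(** A test that is accepted only when it reveals two high types raises the expected joint
    payoff [Pi] of a pair by accuracy * Pr(H, H) * (alpha - Pi).  In every
    allocation some pair has [Pi] at most its prior expected surplus (a matched
    pair, or two unmatched agents), which lies below alpha by a fixed margin.  So
    a cheap informative test leaves no stable allocation at all: the endogenous
    set is empty, and it is a strict subset of any nonempty baseline set. *)
Require Import Defs.
From mathcomp Require Import all_boot all_order all_algebra.
From mathcomp Require Import classical_sets reals.
From mathcomp Require Import ring.

Set Implicit Arguments.
Unset Strict Implicit.
Unset Printing Implicit Defensive.

Import Order.TTheory GRing.Theory Num.Theory.
Local Open Scope ring_scope.
Local Open Scope classical_set_scope.

Section TestValues.
Context {R : realType} (E : primitives R) {F W : finType}.

Let q := high_prob E.
Let N := #|{: F + W}|.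

Lemma sum_bernoulli_mass (p : R) : \sum_b bernoulli_mass p b = 1.
Proof. by rewrite big_bool /= addrC subrK. Qed.

Lemma bernoulli_mass_ge0 (p : R) b : 0 <= p <= 1 -> 0 <= bernoulli_mass p b.
Proof. by case/andP=> p0 p1; case: b; rewrite //= subr_ge0. Qed.

Lemma profile_prob_ge0 (theta : profile) :
  0 <= profile_prob E (F := F) (W := W) theta.
Proof.
apply: prodr_ge0 => a _; apply: bernoulli_mass_ge0.
by case/andP: (high_probP E) => q0 q1; rewrite !ltW.
Qed.

(** Distributivity turns the sum over profiles into a product over agents of sums equal to 1. *)
Lemma sum_profile_prob : \sum_(theta : profile (F := F) (W := W)) profile_prob E theta = 1.
Proof.
rewrite -(bigA_distr_bigA (fun=> bernoulli_mass (high_prob E))) /=.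
by apply: big1 => a _; exact: sum_bernoulli_mass.
Qed.

Lemma profile_prob_const b :
  profile_prob E ([ffun=> b] : profile (F := F) (W := W)) = bernoulli_mass q b ^+ N.
Proof.
by rewrite /profile_prob (eq_bigr (fun=> bernoulli_mass q b)) ?prodr_const // => a _;
   rewrite ffunE.
Qed.

Lemma surplus_ge0 s t : 0 <= surplus E s t.
Proof.
have g0 := surplusLL_ge0 E; have b0 := le_lt_trans g0 (surplusHL_gt E).
by case: s t => [] []; rewrite //= ltW // (lt_trans b0 (surplusHH_gt E)).
Qed.

Lemma surplus_le_HH s t : surplus E s t <= surplusHH E.
Proof.
have hb := surplusHH_gt E; have hg := lt_trans (surplusHL_gt E) hb.
by case: s t => [] [] //=; rewrite ltW.
Qed.

Lemma prior_surplus_ge0 (f : F) (w : W) : 0 <= prior_surplus E f w.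
Proof.
by apply: sumr_ge0 => theta _; rewrite mulr_ge0 ?profile_prob_ge0 ?surplus_ge0.
Qed.

(** The gap is a mean of nonnegative shortfalls from [surplusHH E]; the bound keeps only the term of
    the all-low profile. *)
Lemma prior_surplus_gap (f : F) (w : W) :
  (1 - q) ^+ N * (surplusHH E - surplusLL E) <= surplusHH E - prior_surplus E f w.
Proof.
have -> : surplusHH E - prior_surplus E f w =
    \sum_theta profile_prob E theta * (surplusHH E - pair_surplus E f w theta).
  under eq_bigr do rewrite mulrBr.
  by rewrite sumrB -mulr_suml sum_profile_prob mul1r.
rewrite (bigD1 [ffun=> false]) //= profile_prob_const /pair_surplus !ffunE lerDl.
by apply: sumr_ge0 => theta _; rewrite mulr_ge0 ?profile_prob_ge0 ?subr_ge0 ?surplus_le_HH.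
Qed.

Lemma acceptance_value_le (tau : test R) (f : F) (w : W) (Pi : R) B :
  acceptance_value E tau f w Pi B <= tested_surplus E tau f w Pi.
Proof. exact: le_bigmax. Qed.

(** Accepting after every outcome, revealing or not, yields the prior surplus whatever the
    accuracy. *)
Lemma prior_le_tested_surplus (tau : test R) (f : F) (w : W) (Pi : R) :
  prior_surplus E f w <= tested_surplus E tau f w Pi.
Proof.
apply: le_trans (acceptance_value_le tau f w Pi finset.setT).
rewrite le_eqVlt; apply/orP; left; apply/eqP; apply: eq_bigr => theta _.
under eq_bigr do rewrite finset.in_setT.
by rewrite -mulr_suml -mulr_sumr sum_bernoulli_mass mulr1.
Qed.

Lemma tested_surplus_gain (tau : test R) (f : F) (w : W) (Pi : R) :
  0 <= accuracy tau -> Pi <= surplusHH E ->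
  Pi + accuracy tau * q ^+ N * (surplusHH E - Pi) <= tested_surplus E tau f w Pi.
Proof.
move=> p0 PiH.
(* The pair deviates exactly when the test reveals two high types. *)
apply: le_trans (acceptance_value_le tau f w Pi [set Some (true, true)]%SET).
set av := acceptance_value _ _ _ _ _ _.
have -> : av = Pi + accuracy tau * \sum_(theta : profile) profile_prob E theta *
    (if theta (inl f) && theta (inr w) then surplusHH E - Pi else 0).
  (* [Pi] is written as its own mean over profiles, so that the identity can be checked profile by
     profile. *)
  rewrite -[X in X + _]mul1r -sum_profile_prob mulr_suml mulr_sumr -big_split.
  apply: eq_bigr => theta _; rewrite big_bool /= !finset.in_set1 /pair_surplus.
  by case: (theta (inl f)); case: (theta (inr w)) => //=; ring.
(* The all-high profile alone gives the bound; the other terms are nonnegative because [Pi] is at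
   most [surplusHH E]. *)
rewrite lerD2l -mulrA ler_wpM2l // (bigD1 [ffun=> true]) //= !ffunE /=.
rewrite profile_prob_const lerDl; apply: sumr_ge0 => theta _.
by rewrite mulr_ge0 ?profile_prob_ge0 //; case: ifP; rewrite ?subr_ge0.
Qed.

(** The transfer cancels, since by injectivity of the matching the firm picked in [worker_payoff] is
    [f] itself. *)
Lemma joint_payoff_matched (a : allocation R F W) f w :
  matching a f = Some w -> joint_payoff E a f w = prior_surplus E f w.
Proof.
move=> fw; rewrite /joint_payoff /firm_payoff /worker_payoff fw.
case: pickP => [f' /eqP f'w | /(_ f)]; last by rewrite fw eqxx.
by rewrite (matching_inj f'w fw) subrK.
Qed.

Lemma joint_payoff_unmatched (a : allocation R F W) f w :
  matching a f = None -> (forall f', matching a f' <> Some w) ->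
  joint_payoff E a f w = 0.
Proof.
move=> fN wN; rewrite /joint_payoff /firm_payoff /worker_payoff fN add0r.
by case: pickP => // f' /eqP /wN.
Qed.

(** Start from any firm and any worker: if either is matched, its own match gives equality;
    otherwise the two together have payoff 0. *)
Lemma exists_joint_payoff_le_prior (a : allocation R F W) :
  (0 < #|F|)%N -> (0 < #|W|)%N ->
  exists f w, joint_payoff E a f w <= prior_surplus E f w.
Proof.
case/card_gt0P=> f _ /card_gt0P[w _].
case fw: (matching a f) => [w'|]; first by exists f, w'; rewrite joint_payoff_matched.
have [/existsP[f' /eqP f'w] | /existsPn wN] := boolP [exists f', matching a f' == Some w].
  by exists f', w; rewrite joint_payoff_matched.
exists f, w; rewrite joint_payoff_unmatched ?prior_surplus_ge0 // => f'.
by apply/eqP.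
Qed.

Lemma test_value_le_menu_value n (T : 'I_n -> test R) (a : allocation R F W) f w i :
  test_value E a f w (T i) <= menu_value E T a f w.
Proof. exact: le_bigmax. Qed.

(* [q ^+ N] and [(1 - q) ^+ N] are the probabilities that all agents are high,
   respectively low; they bound below Pr(H, H) and Pr(L, L) for every pair. *)
Definition cost_bound (p : R) : R :=
  p * q ^+ N * ((1 - q) ^+ N * (surplusHH E - surplusLL E)).

Lemma cost_bound_gt0 p : 0 < p -> 0 < cost_bound p.
Proof.
case/andP: (high_probP E) => q0 q1 p0.
rewrite /cost_bound !mulr_gt0 ?exprn_gt0 ?subr_gt0 //.
exact: lt_trans (surplusHL_gt E) (surplusHH_gt E).
Qed.

(** The gain from testing is at least [accuracy tau * q ^+ N] times [surplusHH E - Pi], and the last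
    factor is at least the margin of [prior_surplus_gap]; [cost_bound] is the product of these
    bounds. *)
Lemma cheap_test_blocks (a : allocation R F W) (tau : test R) f w :
  0 < accuracy tau -> cost tau < cost_bound (accuracy tau) ->
  joint_payoff E a f w <= prior_surplus E f w ->
  joint_payoff E a f w < test_value E a f w tau.
Proof.
move=> p0 cp; set Pi := joint_payoff _ _ _ _ => Pi_prior.
have gap : (1 - q) ^+ N * (surplusHH E - surplusLL E) <= surplusHH E - Pi.
  by apply: le_trans (prior_surplus_gap f w) _; rewrite lerD2l lerN2.
have q0 : 0 < q by case/andP: (high_probP E).
have PiH : Pi <= surplusHH E.
  case/andP: (high_probP E) => _ q1; rewrite -subr_ge0; apply: le_trans gap.
  by rewrite mulr_ge0 ?exprn_ge0 ?subr_ge0 ?(surplus_le_HH false false) // ltW.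
rewrite ltrBrDr; apply: lt_le_trans (tested_surplus_gain f w (ltW p0) PiH).
rewrite ltrD2l; apply: lt_le_trans cp _.
by rewrite ler_wpM2l // mulr_ge0 ?exprn_ge0 // ltW.
Qed.

(** Both baseline tests lie in the menu, so a pair that blocks in the baseline also blocks with the
    menu. *)
Lemma Endog_sub_ICPS n (T : 'I_n -> test R) (base : test R) :
  (exists i, T i = null_test) -> (exists i, T i = base) ->
  Sigma_ICPS_Endog E F W T `<=` Sigma_ICPS E F W base.
Proof.
move=> [i Ti] [j Tj] a [ir stable]; split=> // -[f [w block]]; apply: stable; exists f, w.
by case: block => /lt_le_trans; apply; rewrite -?Ti -?Tj; exact: test_value_le_menu_value.
Qed.

(** The null test is free and is worth at least the prior surplus, so a Bayesian block is also a
    block with the null test. *)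
Lemma ICPS_sub_Bayes (base : test R) : Sigma_ICPS E F W base `<=` Sigma_Bayes E F W.
Proof.
move=> a [ir stable]; split=> // -[f [w block]]; apply: stable; exists f, w; left.
by apply: lt_le_trans block _; rewrite /test_value subr0; exact: prior_le_tested_surplus.
Qed.

End TestValues.

Theorem proposition10 (R : realType) (E : primitives R) (F W : finType) :
  (forall (n : nat) (T : 'I_n -> test R) (base : test R),
     is_menu T -> (exists i, T i = base) ->
     Sigma_ICPS_Endog E F W T `<=` Sigma_ICPS E F W base /\
     Sigma_ICPS E F W base `<=` Sigma_Bayes E F W) /\
  ((0 < #|F|)%N -> (0 < #|W|)%N ->
   exists cbar : R -> R,
     (forall p : R, 0 < p -> 0 < cbar p) /\
     forall (n : nat) (T : 'I_n -> test R) (base : test R),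
       is_menu T -> (exists i, T i = base) ->
       Sigma_ICPS E F W base !=set0 ->
       (exists i, 0 < accuracy (T i) /\ cost (T i) < cbar (accuracy (T i))) ->
       Sigma_ICPS_Endog E F W T `<` Sigma_ICPS E F W base).
Proof.
split=> [n T base [_ T_null] T_base | F0 W0].
  by split; [exact: Endog_sub_ICPS | exact: ICPS_sub_Bayes].
exists (@cost_bound R E F W); split=> [p|n T base [_ T_null] T_base [a a_ICPS] [i [p0 cp]]].
  exact: cost_bound_gt0.
split=> [|sub]; first exact: Endog_sub_ICPS.
(* The assumed reverse inclusion would make [a] stable against the menu; a blocking pair refutes
   this. *)
have [_ []] := sub _ a_ICPS.
have [f [w le_prior]] := exists_joint_payoff_le_prior E a F0 W0.
exists f, w; apply: lt_le_trans (cheap_test_blocks p0 cp le_prior) _.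
exact: test_value_le_menu_value.
Qed.
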